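(* If $K\subset\mathbb{R}^n$ is a closed pseudo-cone, then $K^{\ast\ast}=K$. Moreover, if $K\subset\mathbb{R}^n$ is a closed convex set not containing the origin, then $K^{\ast\ast\ast}=K^\ast$.
   Context: A (convex) pseudo-cone is a nonempty convex set $K\subset\mathbb{R}^n$ not containing the origin such that $\lambda x\in K$ for all $x\in K$ and all real $\lambda\geq 1$. For a nonempty closed convex set $K\subset\mathbb{R}^n$, $K^\ast=\{x\in\mathbb{R}^n:\langle x,y\rangle\leq -1\text{ for all }y\in K\}$, where $\langle\cdot,\cdot\rangle$ is the standard inner product; moreover $\emptyset^\ast=\mathbb{R}^n$ and $(\mathbb{R}^n)^\ast=\emptyset$. $K^{\ast\ast}=(K^\ast)^\ast$ and $K^{\ast\ast\ast}=((K^\ast)^\ast)^\ast$. *)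

(* Defs.v *)
From HB Require Import structures.
From mathcomp Require Import all_boot all_order all_algebra.
From mathcomp Require Import all_classical all_reals all_analysis.

Set Implicit Arguments.
Unset Strict Implicit.
Unset Printing Implicit Defensive.

Import Order.TTheory GRing.Theory Num.Theory.
Import numFieldNormedType.Exports.

Local Open Scope classical_set_scope.
Local Open Scope ring_scope.

Definition dot (R : realType) (n : nat) (x y : 'rV[R]_n) : R :=
  \sum_(i < n) x ord0 i * y ord0 i.

Definition pseudo_cone (R : realType) (n : nat) (K : set 'rV[R]_n) : Prop :=
  [/\ K !=set0, convex_set K, ~ K 0 &
      forall (x : 'rV[R]_n) (l : R), K x -> 1 <= l -> K (l *: x)].

(* K^*, defined by the same formula for every set K, with no restriction to
   nonempty closed convex sets; [copolar_set0] and [copolar_setT] show that it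
   gives the conventional values on the empty set and on the whole space. *)
Definition copolar (R : realType) (n : nat) (K : set 'rV[R]_n) :
    set 'rV[R]_n :=
  [set x | forall y, K y -> dot x y <= -1].

Lemma copolar_set0 (R : realType) (n : nat) :
  copolar (set0 : set 'rV[R]_n) = setT.
Proof. by apply/seteqP; split => x //= _ y. Qed.

Lemma copolar_setT (R : realType) (n : nat) :
  copolar (setT : set 'rV[R]_n) = set0.
Proof.
apply/seteqP; split => x //= /(_ 0 I); rewrite /dot big1 ?ler0N1 //.
by move=> i _; rewrite mxE mulr0.
Qed.

(* Main.v *)
(** Any [u] with [<u,y>] bounded above on a pseudo-cone [K] is nonpositive on
    [K], since [K] is stable under dilations. Let [z] lie outside [K], and let
    [u] strictly separate [z] from [K]: [<u,y> <= c < <u,z>] on [K], [c <= 0].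
    If [c < 0] then [- c^-1 u] lies in [K^*] and is a witness against
    [z \in K^**]. If [c = 0], then separating [0] from [K] gives some
    [v \in K^*], and [v + t u] is such a witness for large [t]. The second
    claim only uses that the copolar is an antitone Galois connection. *)
Require Import Defs.
From mathcomp Require Import all_boot all_order all_algebra.
From mathcomp Require Import all_classical all_reals all_analysis.
From mathcomp Require Import lra.
Import Order.TTheory GRing.Theory Num.Theory.
Import numFieldNormedType.Exports.
Local Open Scope classical_set_scope.
Local Open Scope ring_scope.

Section Dot.
Context {R : realType} {n : nat}.
Implicit Types x y z : 'rV[R]_n.

Lemma dotC x y : dot x y = dot y x.
Proof. by apply: eq_bigr => i _; rewrite mulrC. Qed.

Lemma dotDl x y z : dot (x + y) z = dot x z + dot y z.
Proof. by rewrite -big_split; apply: eq_bigr => i _; rewrite mxE mulrDl. Qed.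

Lemma dotZl a x y : dot (a *: x) y = a * dot x y.
Proof. by rewrite /dot mulr_sumr; apply: eq_bigr => i _; rewrite mxE mulrA. Qed.

Lemma dotNl x y : dot (- x) y = - dot x y.
Proof. by rewrite -scaleN1r dotZl mulN1r. Qed.

Lemma dotDr x y z : dot x (y + z) = dot x y + dot x z.
Proof. by rewrite !(dotC x) dotDl. Qed.

Lemma dotZr a x y : dot x (a *: y) = a * dot x y.
Proof. by rewrite !(dotC x) dotZl. Qed.

Lemma dotNr x y : dot x (- y) = - dot x y.
Proof. by rewrite !(dotC x) dotNl. Qed.

Lemma dot0r x : dot x 0 = 0.
Proof. by rewrite -(scale0r 0) dotZr mul0r. Qed.

Lemma coord_sqr_le_dot x i : x ord0 i ^+ 2 <= dot x x.
Proof.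
rewrite /dot (bigD1 i) //= -expr2 lerDl sumr_ge0 // => j _.
by rewrite -expr2 sqr_ge0.
Qed.

Lemma dot_ge0 x : 0 <= dot x x.
Proof. by apply: sumr_ge0 => i _; rewrite -expr2 sqr_ge0. Qed.

Lemma dot_gt0 x : x != 0 -> 0 < dot x x.
Proof.
rewrite lt_neqAle dot_ge0 andbT; apply: contraNneq => x0.
apply/eqP/rowP => i; rewrite mxE; apply/eqP; rewrite -sqrf_eq0 eq_le sqr_ge0.
by rewrite x0 coord_sqr_le_dot.
Qed.

Lemma sqr_dist_continuous z : continuous (fun y => dot (z - y) (z - y)).
Proof.
have zc i : continuous (fun y : 'rV[R]_n => (z - y) ord0 i).
  have -> : (fun y : 'rV[R]_n => (z - y) ord0 i) =
            (fun y => z ord0 i - y ord0 i) by apply/funext => y; rewrite !mxE.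
  move=> y; apply: continuousB; first exact: cst_continuous.
  exact: coord_continuous.
apply: continuous_big => [|i _ y]; first exact: add_continuous.
by apply: continuousM; exact: zc.
Qed.

End Dot.

Section Separation.
Context {R : realType} {n : nat}.
Implicit Types (K : set 'rV[R]_n) (x y z : 'rV[R]_n).

Lemma convex_set_segment K x y (l : R) : convex_set K -> K x -> K y ->
  0 <= l -> l <= 1 -> K (x + l *: (y - x)).
Proof.
move=> cK Kx Ky l0 l1.
have := cK y x (Itv01 l0 l1) (mem_set Ky) (mem_set Kx); rewrite inE.
congr (K _).
by rewrite /conv /= scalerBl scale1r scalerBr addrCA.
Qed.

(** [K] may be unbounded, so the squared distance is minimised over the part of [K] in a compact box
    around [z]. *)
Lemma closest_point K z : closed K -> K !=set0 -> exists2 p, K p &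
  forall y, K y -> dot (z - p) (z - p) <= dot (z - y) (z - y).
Proof.
move=> clK [k Kk].
pose s := dot (z - k) (z - k).
(* The half-width [s + 1] exceeds the square root of [s], so the box contains every point at squared
   distance at most [s] from [z], in particular [k]. *)
pose box := [set v : 'rV[R]_n |
  forall i, `[z ord0 i - (s + 1), z ord0 i + (s + 1)]%classic (v ord0 i)].
have cbox : compact box.
  by apply: (@rV_compact _ _ (fun i => `[_, _]%classic)) => i;
    exact: segment_compact.
have inbox y : dot (z - y) (z - y) <= s -> box y.
  move=> ys i /=; rewrite in_itv /=.
  have := le_trans (coord_sqr_le_dot (z - y) i) ys; rewrite !mxE => h.
  have s0 : 0 <= s by exact: dot_ge0.
  by apply/andP; split; nra.
have cA : compact (box `&` K) by exact: compact_closedI.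
have [|p] := EVT_min_rV _ cA (continuous_subspaceT (sqr_dist_continuous z)).
  by exists k; split=> //; exact: inbox.
rewrite inE => -[_ Kp] pmin; exists p => // y Ky.
(* Points farther from [z] than [k] may leave the box, but [k] already beats them. *)
have [ys|/ltW sy] := leP (dot (z - y) (z - y)) s.
  by apply: pmin; rewrite inE; split=> //; exact: inbox.
by apply: le_trans sy; apply: pmin; rewrite inE; split=> //; exact: inbox.
Qed.

(** The normal is [z - p] with [p] the point of [K] closest to [z]. Returning [p] records that the
    supremum of [dot u] on [K] is attained. *)
Lemma separation K z : closed K -> convex_set K -> K !=set0 -> ~ K z ->
  exists2 p, K p & exists u, (forall y, K y -> dot u y <= dot u p) /\
    dot u p < dot u z.
Proof.
move=> clK cK K0 nKz; have [p Kp pmin] := closest_point _ z clK K0.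
exists p => //; exists (z - p); split; last first.
  rewrite -subr_gt0 -dotNr -dotDr dot_gt0 // subr_eq0.
  by apply: contra_notN nKz => /eqP ->.
move=> y Ky; rewrite -subr_le0 -dotNr -dotDr leNgt; apply/negP.
set u := z - p; set w := y - p; set a := dot u w => a0.
have b0 := dot_ge0 w; set b := dot w w in b0.
(* Moving from [p] towards [y] by the fraction [a / (a + b)] would bring us
   closer to [z]. *)
have ab0 : 0 < a + b by lra.
pose l := a / (a + b).
have l0 : 0 < l by rewrite divr_gt0.
have l1 : l <= 1 by rewrite ler_pdivrMr // mul1r lerDl.
have /pmin := convex_set_segment _ _ _ _ cK Kp Ky (ltW l0) l1.
rewrite opprD addrA -/u -/w; clearbody u w.
rewrite !(dotDl, dotDr, dotNl, dotNr, dotZl, dotZr).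
rewrite (dotC w u) -/a -/b => h.
(* Here [h] reduces to [2 * l * a <= l ^+ 2 * b], hence [2 * a <= l * b], whereas
   [l * b = a - l * a < a]. *)
have lab : l * (a + b) = a by rewrite mulfVK // gt_eqF.
nra.
Qed.

End Separation.

Section Copolar.
Context {R : realType} {n : nat}.
Implicit Types K L : set 'rV[R]_n.

Lemma sub_copolar2 K : K `<=` copolar (copolar K).
Proof. by move=> x Kx y /(_ x Kx); rewrite dotC. Qed.

Lemma copolar_anti K L : K `<=` L -> copolar L `<=` copolar K.
Proof. by move=> KL x Lx y /KL; exact: Lx. Qed.

Lemma copolar3 K : copolar (copolar (copolar K)) = copolar K.
Proof.
apply/seteqP; split; last exact: sub_copolar2.
exact/copolar_anti/sub_copolar2.
Qed.

(** The factor normalises the maximum of [dot u] on [K] to [-1]. *)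
Lemma copolar_scale K p u : dot u p < 0 ->
  (forall y, K y -> dot u y <= dot u p) -> copolar K ((- dot u p)^-1 *: u).
Proof.
move=> up0 uK y /uK uy; rewrite dotZl ler_pdivrMl ?oppr_gt0 //.
by rewrite mulrN1 opprK.
Qed.

Lemma copolar_nonempty K : closed K -> pseudo_cone K -> copolar K !=set0.
Proof.
move=> clK [K0 cK nK0 _].
have [p _ [u [uK]]] := separation _ _ clK cK K0 nK0.
by rewrite dot0r => up0; exists ((- dot u p)^-1 *: u); exact: copolar_scale.
Qed.

(** The point [2 *: p] is again in [K], so doubling the maximum cannot increase it. *)
Lemma pseudo_cone_dot_le0 K p u : pseudo_cone K -> K p ->
  (forall y, K y -> dot u y <= dot u p) -> dot u p <= 0.
Proof.
move=> [_ _ _ coneK] Kp uK.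
have /uK : K (2 *: p) by apply: coneK => //; lra.
rewrite dotZr; lra.
Qed.

Lemma copolar2_pseudo_cone K : closed K -> pseudo_cone K ->
  copolar (copolar K) = K.
Proof.
move=> clK pK; apply/seteqP; split; last exact: sub_copolar2.
move=> z K2z; apply: contrapT => nKz.
have [K0 cK _ _] := pK.
have [p Kp [u [uK upz]]] := separation _ _ clK cK K0 nKz.
have := pseudo_cone_dot_le0 _ _ _ pK Kp uK; rewrite le_eqVlt => /predU1P[up0|up0].
  have [v Kv] := copolar_nonempty _ clK pK.
  rewrite up0 in uK upz.
  (* With this [t], the pairing of [z] with [v + t *: u] is [dot z v] plus its absolute value, hence
     nonnegative and not at most [-1]. *)
  pose t := `|dot z v| / dot u z.
  have t0 : 0 <= t by rewrite divr_ge0 // ltW.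
  have /K2z : copolar K (v + t *: u).
    move=> y Ky; rewrite dotDl dotZl; have := Kv y Ky; have := uK y Ky; nra.
  rewrite dotDr dotZr (dotC z u) divfK ?gt_eqF //.
  by have := ler_norm (- dot z v); rewrite normrN; lra.
(* Clearing the scalar turns the bound [-1] into [dot u z <= dot u p], against strict separation. *)
have /K2z := copolar_scale _ _ _ up0 uK.
rewrite dotZr ler_pdivrMl ?oppr_gt0 // mulrN1 opprK dotC.
by rewrite leNgt upz.
Qed.

End Copolar.

Theorem theorem3p9 (R : realType) (n : nat) :
  (forall K : set 'rV[R]_n, closed K -> pseudo_cone K ->
     copolar (copolar K) = K) /\
  (forall K : set 'rV[R]_n, closed K -> convex_set K -> ~ K 0 ->
     copolar (copolar (copolar K)) = copolar K).
Proof.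
split=> [K|K _ _ _]; first exact: copolar2_pseudo_cone.
exact: copolar3.
Qed.
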